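(* Let $(K_{i,j})_{i,j\ge1}$ and $(J_{i,j})_{i,j\ge 1}$ be real numbers with $0\le K_{i,j}=K_{j,i}$ and $0\le J_{i,j}=J_{j,i}$ for all $i,j\ge1$, and assume that there is a non-negative real sequence $(\rho_i)_{i\ge1}$ with $$K_{i,j}\le\rho_i\rho_j,\quad J_{i,j}\le\rho_i\rho_j\quad(i,j\ge1),\qquad \lim_{i\to\infty}\frac{\rho_i}{i}=0 .$$ Let $T>0$, let $a^0,b^0\in X_1^+$, and let $(a,b)$ be a solution on $[0,T]$ of the coagulation--annihilation system with rates $K$, $J$ and initial data $(a^0,b^0)$, satisfying $$\|a(t)\|_1\le\|a^0\|_1,\qquad \|b(t)\|_1\le\|b^0\|_1\qquad\text{for all }t\in[0,T].$$ Then the solution is continuously differentiable, i.e. for every $i\in\mathbb{N}$ the functions $a_i$ and $b_i$ are continuously differentiable on $(0,T)$.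
   Context: For $p\in\mathbb{R}$, $X_p$ is the space of real sequences $x=(x_i)_{i\ge1}$ with $\|x\|_p=\sum_{i=1}^\infty i^p|x_i|<\infty$, and $X_p^+=\{x\in X_p: x_i\ge0\text{ for all }i\ge1\}$. The coagulation--annihilation system is, for $i\in\mathbb{N}=\{1,2,\dots\}$ and $t>0$, $$\frac{da_i}{dt}=\frac12\sum_{j=1}^{i-1}K_{j,i-j}a_ja_{i-j}-\sum_{j=1}^\infty K_{i,j}a_ia_j-\sum_{j=1}^\infty J_{i,j}a_ib_j,\qquad \frac{db_i}{dt}=\frac12\sum_{j=1}^{i-1}K_{j,i-j}b_jb_{i-j}-\sum_{j=1}^\infty K_{i,j}b_ib_j-\sum_{j=1}^\infty J_{i,j}b_ia_j,$$ with $a_i(0)=a_i^0\ge0$, $b_i(0)=b_i^0\ge0$ (for $i=1$ the first sums are zero). Solution: a pair $(a,b)=((a_i)_{i\ge1},(b_i)_{i\ge1})$ of sequences of non-negative functions is a solution on $[0,T]$ with initial data $(a^0,b^0)$ if (1) $a_i,b_i\in C([0,T])$ for each $i\in\mathbb{N}$; (2) for each $i\in\mathbb{N}$ and $t\in[0,T]$, the functions $\sum_{j=1}^\infty K_{i,j}a_j$, $\sum_{j=1}^\infty K_{i,j}b_j$, $\sum_{j=1}^\infty J_{i,j}a_j$, $\sum_{j=1}^\infty J_{i,j}b_j$ belong to $L^1(0,t)$; (3) for each $i\in\mathbb{N}$ and $t\in(0,T]$, $$a_i(t)=a_i^0+\int_0^t\Big(\tfrac12\sum_{j=1}^{i-1}K_{j,i-j}a_j(s)a_{i-j}(s)-a_i(s)\sum_{j=1}^\infty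 K_{i,j}a_j(s)-a_i(s)\sum_{j=1}^\infty J_{i,j}b_j(s)\Big)ds,$$ $$b_i(t)=b_i^0+\int_0^t\Big(\tfrac12\sum_{j=1}^{i-1}K_{j,i-j}b_j(s)b_{i-j}(s)-b_i(s)\sum_{j=1}^\infty K_{i,j}b_j(s)-b_i(s)\sum_{j=1}^\infty J_{i,j}a_j(s)\Big)ds.$$ *)

(* Defs.v *)
From HB Require Import structures.
From mathcomp Require Import all_boot all_order all_algebra.
From mathcomp Require Import all_classical all_reals all_analysis.

Set Implicit Arguments.
Unset Strict Implicit.
Unset Printing Implicit Defensive.

Import Order.TTheory GRing.Theory Num.Theory.
Import numFieldNormedType.Exports.

Local Open Scope classical_set_scope.
Local Open Scope ring_scope.

(* Sequences indexed by {1, 2, ...} are represented by functions on nat whose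
   value at index 0 is never used; time-dependent quantities are total functions
   of a real variable of which only the values on [0, T] matter. *)

(* Valued in \bar R, so that it equals +oo when the series diverges. *)
Definition Xnorm (R : realType) (p : R) (x : nat -> R) : \bar R :=
  (\sum_(1 <= i <oo) (i%:R `^ p * `|x i|)%:E)%E.

Definition X (R : realType) (p : R) : set (nat -> R) :=
  [set x | (Xnorm p x < +oo)%E].

Definition Xplus (R : realType) (p : R) : set (nat -> R) :=
  [set x | X p x /\ forall i, (1 <= i)%N -> 0 <= x i].

(* The series is taken in \bar R: for non-negative terms it always makes sense,
   with value +oo in case of divergence. *)
Definition rate_sum (R : realType) (M : nat -> nat -> R) (u : nat -> R -> R)
    (i : nat) (s : R) : \bar R :=
  (\sum_(1 <= j <oo) (M i j * u j s)%:E)%E.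

(* Right-hand side of the i-th equation for the species u, v being the other
   species. *)
Definition rhs (R : realType) (K J : nat -> nat -> R) (u v : nat -> R -> R)
    (i : nat) (s : R) : \bar R :=
  ((2^-1 * \sum_(1 <= j < i) K j (i - j)%N * u j s * u (i - j)%N s)%R%:E
   - (u i s)%:E * rate_sum K u i s
   - (u i s)%:E * rate_sum J v i s)%E.

Record is_solution (R : realType) (K J : nat -> nat -> R) (T : R)
    (a0 b0 : nat -> R) (a b : nat -> R -> R) : Prop := IsSolution {
  sol_nonneg : forall (i : nat) (t : R), (1 <= i)%N -> 0 <= t <= T ->
    0 <= a i t /\ 0 <= b i t ;
  sol_continuous : forall i, (1 <= i)%N ->
    {within `[0, T], continuous (a i)} /\ {within `[0, T], continuous (b i)} ;
  sol_integrable : forall (i : nat) (t : R), (1 <= i)%N -> 0 <= t <= T ->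
    [/\ lebesgue_measure.-integrable `]0, t[ (rate_sum K a i),
        lebesgue_measure.-integrable `]0, t[ (rate_sum K b i),
        lebesgue_measure.-integrable `]0, t[ (rate_sum J a i) &
        lebesgue_measure.-integrable `]0, t[ (rate_sum J b i)] ;
  sol_equation : forall (i : nat) (t : R), (1 <= i)%N -> 0 < t <= T ->
    ((a i t)%:E =
       (a0 i)%:E + \int[lebesgue_measure]_(s in `]0%R, t[) rhs K J a b i s)%E /\
    ((b i t)%:E =
       (b0 i)%:E + \int[lebesgue_measure]_(s in `]0%R, t[) rhs K J b a i s)%E
}.

Definition continuously_differentiable_on (R : realType) (D : set R)
    (f : R -> R) : Prop :=
  (forall t, D t -> derivable f t 1) /\ {within D, continuous (derive1 f)}.

(* Main.v *)
(* Write C for a common bound of the two weighted norms on [0, T]. Since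
   K i j <= rho i * rho j = o(j), the tail of sum_j K i j * u j from n on is at
   most d * C, where d = sup_(j >= n) K i j / j tends to 0. The rate sums thus
   converge uniformly on [0, T], so their limits are continuous, and the
   integral equation can be differentiated. *)

Require Import Defs.
From HB Require Import structures.
From mathcomp Require Import all_boot all_order all_algebra.
From mathcomp Require Import all_classical all_reals all_analysis.

Set Implicit Arguments.
Unset Strict Implicit.
Unset Printing Implicit Defensive.

Import Order.TTheory GRing.Theory Num.Theory.
Import numFieldNormedType.Exports.

Local Open Scope classical_set_scope.
Local Open Scope ring_scope.

(** From index [n] on, each term is at most [d] times the matching term of the norm series, so the
    tail costs at most [d * C]. Naming the tail as a real [r] yields both finiteness of the series
    and an explicit truncation error. *)
Lemma weighted_series_split (R : realType) (m u : nat -> R) (C d : R) (n : nat)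
    (m_ge0 : forall j, (1 <= j)%N -> 0 <= m j)
    (u_ge0 : forall j, (1 <= j)%N -> 0 <= u j)
    (uC : (Xnorm 1 u <= C%:E)%E)
    (n_gt0 : (1 <= n)%N) (d_ge0 : 0 <= d)
    (md : forall j, (n <= j)%N -> m j <= d * j%:R) :
  exists2 r : R, 0 <= r <= d * C &
    (\sum_(1 <= j <oo) (m j * u j)%:E)%E =
      (\sum_(1 <= j < n) m j * u j + r)%:E.
Proof.
have mu_ge0 j : (1 <= j)%N -> (0 <= (m j * u j)%:E)%E.
  by move=> j1; rewrite lee_fin mulr_ge0 ?m_ge0 ?u_ge0.
have w_ge0 j : (0 <= (j%:R `^ 1 * `|u j|)%:E)%E.
  by rewrite lee_fin mulr_ge0 ?powR_ge0.
set t := (\sum_(n <= j <oo) (m j * u j)%:E)%E.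
have t_ge0 : (0 <= t)%E.
  by apply: nneseries_ge0 => j nj _; apply: mu_ge0; exact: leq_trans nj.
have t_le : (t <= (d * C)%:E)%E.
  apply: (@le_trans _ _
    (\sum_(n <= j <oo) (d%:E * (j%:R `^ 1 * `|u j|)%:E))%E).
    (* The lower bound of the sum becomes a condition on the index, so that [n <= j] is available
       when comparing terms. *)
    rewrite /t eseries_cond [leRHS]eseries_cond; apply: lee_nneseries => j /=.
      by move=> _ nj; apply: mu_ge0; exact: leq_trans nj.
    move=> nj; have j1 : (1 <= j)%N by exact: leq_trans nj.
    rewrite -EFinM lee_fin powRr1// ger0_norm ?u_ge0// mulrA.
    by rewrite ler_wpM2r ?u_ge0 ?md.
  rewrite nneseriesZl// EFinM lee_wpmul2l ?lee_fin//; apply: le_trans uC.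
  (* Indices start at 1, so splitting off [n.-1] terms leaves the tail that starts at [n]. *)
  rewrite /Xnorm (@nneseries_split _ _ 1 n.-1)// add1n prednK//.
  by rewrite leeDr// sume_ge0.
have t_fin : t \is a fin_num by rewrite ge0_fin_numE// (le_lt_trans t_le) ?ltry.
exists (fine t); first by rewrite -!lee_fin fineK// t_ge0 t_le.
rewrite (@nneseries_split _ _ 1 n.-1)// add1n prednK//.
by rewrite EFinD fineK// sumEFin.
Qed.

Lemma weighted_series_fin_num (R : realType) (m u : nat -> R) (C : R)
    (m_ge0 : forall j, (1 <= j)%N -> 0 <= m j)
    (m_cvg : m j / j%:R @[j --> \oo] --> (0 : R))
    (u_ge0 : forall j, (1 <= j)%N -> 0 <= u j)
    (uC : (Xnorm 1 u <= C%:E)%E) :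
  (\sum_(1 <= j <oo) (m j * u j)%:E)%E \is a fin_num.
Proof.
have /cvgr0Pnorm_le/(_ _ ltr01)[N _ mN] := m_cvg.
(* Only finiteness matters here, so any positive [d] would do. Starting at [N.+1] keeps the indices
   positive, as needed to divide by [j]. *)
have [||j Nj|r _ ->//] :=
  @weighted_series_split _ m u C 1 N.+1 m_ge0 u_ge0 uC => //.
rewrite -ler_pdivrMr ?ltr0n; last exact: leq_trans Nj.
by apply: le_trans (ler_norm _) (mN _ _); exact: ltnW.
Qed.

Lemma weighted_series_continuous (R : realType) (m : nat -> R)
    (u : nat -> R -> R) (C : R) (D : set R)
    (m_ge0 : forall j, (1 <= j)%N -> 0 <= m j)
    (m_cvg : m j / j%:R @[j --> \oo] --> (0 : R))
    (u_ge0 : forall j (s : R), (1 <= j)%N -> D s -> 0 <= u j s)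
    (u_cont : forall j, (1 <= j)%N -> {within D, continuous (u j)})
    (uC : forall s, D s -> (Xnorm 1 (u ^~ s) <= C%:E)%E) :
  {within D, continuous
    (fun s => fine (\sum_(1 <= j <oo) (m j * u j s)%:E)%E)}.
Proof.
pose S n s := \sum_(1 <= j < n) m j * u j s.
(* The partial sums are finite sums of continuous functions; what remains after their continuity is
   convergence uniform on [D]. *)
apply: (@uniform_limit_continuous_subspace _ _ _ (S @ \oo)).
  near_simpl; apply: nearW => n; rewrite /S.
  under eq_fun do rewrite big_nat.
  apply: continuous_big; first exact: add_continuous.
  move=> j /andP[j1 _] x; apply: cvgM; first exact: cvg_cst.
  exact: u_cont.
move=> P /uniform_nbhs[E [/= + EP]].
rewrite -entourage_ballE => -[e /= e0 eE].
(* With this [d] the error bound [d * C] is strictly below [e] whatever the sign of [C], and [C = 0]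
   causes no division by zero. *)
have d0 : 0 < e / (1 + `|C|) by rewrite divr_gt0// ltr_pwDl.
have /cvgr0Pnorm_le/(_ _ d0)[N _ mN] := m_cvg.
exists N.+1 => // n /= Nn; apply: EP => s Ds; apply: eE => /=.
have n0 : (0 < n)%N by exact: leq_trans Nn.
have [j j1|j nj|r /andP[r0 rdC] rE] := @weighted_series_split _ m (u ^~ s) C
  (e / (1 + `|C|)) n m_ge0 _ (uC _ Ds) n0 (ltW d0).
- exact: u_ge0.
- rewrite -ler_pdivrMr ?ltr0n; last exact: leq_trans nj.
  apply: le_trans (ler_norm _) (mN _ _).
  by apply: leq_trans nj; exact: ltnW.
- rewrite /ball/= rE/= /S addrAC subrr add0r ger0_norm//.
  rewrite (le_lt_trans rdC)// mulrAC ltr_pdivrMr ?ltr_pwDl// ltr_pM2l//.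
  by rewrite (le_lt_trans (ler_norm C))// ltrDr.
Qed.

Lemma integral_continuously_differentiable (R : realType) (T c : R)
    (f g : R -> R)
    (g_cont : {within `[0, T], continuous g})
    (fE : forall t : R, 0 < t < T ->
      (f t)%:E = (c%:E + \int[lebesgue_measure]_(s in `]0%R, t[) (g s)%:E)%E) :
  continuously_differentiable_on `]0, T[ f.
Proof.
(* The right end is closed to fit the fundamental theorem of calculus, applied below with left bound
   [BRight 0]; adding the single point [t] leaves the integral unchanged. *)
pose F t := \int[lebesgue_measure]_(s in `]0, t]) (g s).
have g_int : lebesgue_measure.-integrable `[0, T] (EFin \o g).
  by apply: continuous_compact_integrable => //; exact: segment_compact.
have fF (t : R) : 0 < t < T -> f t = c + F t.
  move=> /andP[t0 tT]; have t_int : lebesgue_measure.-integrable `]0, t[ (EFin \o g).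
    by apply: integrableS g_int => //; apply: subset_itv; rewrite bnd_simp// ltW.
  rewrite /F -Rintegral_itv_bndo_bndc//.
  apply: EFin_inj; rewrite fE ?t0// EFinD; congr (_ + _)%E.
  by rewrite /Rintegral fineK// integrable_fin_num.
have fg (t : R) : t \in `]0, T[ -> derivable f t 1 /\ derive1 f t = g t.
  move=> tT; have /andP[t0 t1] : 0 < t < T by move: tT; rewrite in_itv.
  have [|||dF Fg] := @continuous_FTC1 _ g (BRight 0) t T t1 _ _ _.
  - by apply: integrableS g_int => //; apply: subset_itv; rewrite bnd_simp.
  - by [].
  - exact: within_continuous_continuous (lt_trans t0 t1) g_cont tT.
  (* [f] is known to equal [c + F] on the open interval only, which is enough since differentiation
     is local. *)
  have cFf : {near t, (fun y => c + F y) =1 f}.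
    near=> y; rewrite fF//; suff : y \in `]0, T[ by rewrite in_itv.
    by near: y; exact: near_in_itvoo.
  have dcF : is_derive t 1 (fun y => c + F y) (g t).
    rewrite -[g t]add0r; apply: is_deriveD.
    by rewrite -Fg derive1E; exact: derivableP.
  split; first by apply: near_eq_derivable cFf _.
  by rewrite derive1E -(near_eq_derive _ cFf) derive_val.
split=> [t tT|]; first by have [] := fg t tT.
(* On the open interval the derivative is [g], so it inherits the continuity of [g] on [[0, T]]. *)
apply: (@subspace_eq_continuous _ _ _ g).
  by move=> t; rewrite inE => /fg[].
by apply: continuous_subspaceW g_cont; exact: subset_itv_oo_cc.
Unshelve. all: by end_near. Qed.

(** The system is symmetric under exchange of the two species, so one statement about [u] against
    [v] serves for both. *)
Lemma species_continuously_differentiable (R : realType)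
    (K J : nat -> nat -> R) (T c C : R) (u v : nat -> R -> R) (i : nat)
    (K_ge0 : forall j, (1 <= j)%N -> 0 <= K i j)
    (J_ge0 : forall j, (1 <= j)%N -> 0 <= J i j)
    (K_cvg : K i j / j%:R @[j --> \oo] --> (0 : R))
    (J_cvg : J i j / j%:R @[j --> \oo] --> (0 : R))
    (u_ge0 : forall j (s : R), (1 <= j)%N -> 0 <= s <= T -> 0 <= u j s)
    (v_ge0 : forall j (s : R), (1 <= j)%N -> 0 <= s <= T -> 0 <= v j s)
    (u_cont : forall j, (1 <= j)%N -> {within `[0, T], continuous (u j)})
    (v_cont : forall j, (1 <= j)%N -> {within `[0, T], continuous (v j)})
    (uC : forall s : R, 0 <= s <= T -> (Xnorm 1 (u ^~ s) <= C%:E)%E)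
    (vC : forall s : R, 0 <= s <= T -> (Xnorm 1 (v ^~ s) <= C%:E)%E)
    (i_gt0 : (1 <= i)%N)
    (uE : forall t : R, 0 < t < T ->
      (u i t)%:E = (c%:E +
        \int[lebesgue_measure]_(s in `]0%R, t[) rhs K J u v i s)%E) :
  continuously_differentiable_on `]0, T[ (u i).
Proof.
(* [fine] sends infinite values to 0, so the integrand built from [G] and [H] agrees with [rhs] only
   once both rate sums are shown finite, at the end of this proof. *)
pose G s := fine (rate_sum K u i s); pose H s := fine (rate_sum J v i s).
pose P s := 2^-1 * \sum_(1 <= j < i) K j (i - j)%N * u j s * u (i - j)%N s.
have G_cont : {within `[0, T], continuous G}.
  apply: (weighted_series_continuous K_ge0 K_cvg _ u_cont) => [j s j1|s];
    by rewrite /= in_itv; first [exact: u_ge0|exact: uC].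
have H_cont : {within `[0, T], continuous H}.
  apply: (weighted_series_continuous J_ge0 J_cvg _ v_cont) => [j s j1|s];
    by rewrite /= in_itv; first [exact: v_ge0|exact: vC].
have P_cont : {within `[0, T], continuous P}.
  (* Repeating the range as a filter gives access to [1 <= j] and [j < i]; both [j] and [i - j] are
     then at least 1, where continuity is assumed. *)
  have -> : P = fun s => 2^-1 *
      \sum_(1 <= j < i | (1 <= j < i)%N) K j (i - j)%N * u j s * u (i - j)%N s.
    by apply/funext => s; rewrite /P big_nat.
  move=> x; apply: cvgM; first exact: cvg_cst; move: x.
  apply: continuous_big; first exact: add_continuous.
  move=> j /andP[j1 ji] x; apply: cvgM; last by apply: u_cont; rewrite subn_gt0.
  by apply: cvgM; [exact: cvg_cst|exact: u_cont].
apply: (@integral_continuously_differentiable _ T c _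
  (fun s => P s - u i s * G s - u i s * H s)).
  move=> x; apply: cvgB; last by apply: cvgM; [exact: u_cont|exact: H_cont].
  apply: cvgB; first exact: P_cont.
  by apply: cvgM; [exact: u_cont|exact: G_cont].
move=> t /[dup] tT /uE ->; congr (_ + _)%E.
apply: eq_integral => s; rewrite inE/= in_itv/= => /andP[s0 st].
have sT : 0 <= s <= T.
  by case/andP: tT => _ tT; rewrite (ltW s0) (ltW (lt_trans st tT)).
rewrite /rhs !EFinB !EFinM !fineK//.
- by apply: weighted_series_fin_num J_ge0 J_cvg _ (vC _ sT) => j j1; exact: v_ge0.
- by apply: weighted_series_fin_num K_ge0 K_cvg _ (uC _ sT) => j j1; exact: u_ge0.
Qed.

(** Meant for a row of [K] or [J], with [r] equal to [rho i]: after division by [j], the row is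
    squeezed between 0 and [r * (rho j / j)]. *)
Lemma rate_sublinear (R : realType) (m rho : nat -> R) (r : R)
    (m_ge0 : forall j, (1 <= j)%N -> 0 <= m j)
    (m_le : forall j, (1 <= j)%N -> m j <= r * rho j)
    (rho_cvg : rho j / j%:R @[j --> \oo] --> (0 : R)) :
  m j / j%:R @[j --> \oo] --> (0 : R).
Proof.
apply: (@squeeze_cvgr _ _ _ _ (cst 0) (fun j => r * (rho j / j%:R))).
- near=> j; have j1 : (1 <= j)%N by near: j; exists 1%N.
  by rewrite divr_ge0 ?m_ge0//= mulrA ler_wpM2r ?invr_ge0 ?m_le.
- exact: cvg_cst.
- by rewrite -[X in _ --> X](mulr0 r); apply: cvgM => //; exact: cvg_cst.
Unshelve. all: by end_near. Qed.

Theorem proposition6p1 (R : realType) (K J : nat -> nat -> R) (rho : nat -> R)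
  (T : R) (a0 b0 : nat -> R) (a b : nat -> R -> R)
  (hK : forall i j, (1 <= i)%N -> (1 <= j)%N -> 0 <= K i j /\ K i j = K j i)
  (hJ : forall i j, (1 <= i)%N -> (1 <= j)%N -> 0 <= J i j /\ J i j = J j i)
  (hrho : forall i, (1 <= i)%N -> 0 <= rho i)
  (hKrho : forall i j, (1 <= i)%N -> (1 <= j)%N -> K i j <= rho i * rho j)
  (hJrho : forall i j, (1 <= i)%N -> (1 <= j)%N -> J i j <= rho i * rho j)
  (hlim : (rho i / i%:R) @[i --> \oo] --> (0 : R))
  (hT : 0 < T)
  (ha0 : Xplus 1 a0) (hb0 : Xplus 1 b0)
  (hsol : is_solution K J T a0 b0 a b)
  (hnorm : forall t : R, 0 <= t <= T ->
    (Xnorm 1 (fun i => a i t) <= Xnorm 1 a0)%E /\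
    (Xnorm 1 (fun i => b i t) <= Xnorm 1 b0)%E) :
  forall i, (1 <= i)%N ->
    continuously_differentiable_on `]0, T[ (a i) /\
    continuously_differentiable_on `]0, T[ (b i).
Proof.
move=> i i1.
have [norm_a norm_b] : (Xnorm 1 a0 < +oo)%E /\ (Xnorm 1 b0 < +oo)%E.
  by case: ha0; case: hb0.
have Xnorm_ge0 (x : nat -> R) : (0 <= Xnorm 1 x)%E.
  by apply: nneseries_ge0 => j _ _; rewrite lee_fin mulr_ge0 ?powR_ge0.
(* The sum of the initial norms bounds both species at once, since each norm is non-negative. *)
set C := fine (Xnorm 1 a0 + Xnorm 1 b0)%E.
have C_fin : (Xnorm 1 a0 + Xnorm 1 b0)%E \is a fin_num.
  by rewrite ge0_fin_numE ?adde_ge0// lte_add_pinfty.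
have aC (s : R) : 0 <= s <= T -> (Xnorm 1 (a ^~ s) <= C%:E)%E.
  by move=> /hnorm[+ _]; rewrite /C fineK// => /le_trans; apply; rewrite leeDl.
have bC (s : R) : 0 <= s <= T -> (Xnorm 1 (b ^~ s) <= C%:E)%E.
  by move=> /hnorm[_ +]; rewrite /C fineK// => /le_trans; apply; rewrite leeDr.
have K_ge0 j : (1 <= j)%N -> 0 <= K i j by move=> j1; have [] := hK _ _ i1 j1.
have J_ge0 j : (1 <= j)%N -> 0 <= J i j by move=> j1; have [] := hJ _ _ i1 j1.
have K_cvg := rate_sublinear K_ge0 (fun j => hKrho i j i1) hlim.
have J_cvg := rate_sublinear J_ge0 (fun j => hJrho i j i1) hlim.
have a_ge0 j (s : R) : (1 <= j)%N -> 0 <= s <= T -> 0 <= a j s.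
  by move=> j1 /(sol_nonneg hsol j1)[].
have b_ge0 j (s : R) : (1 <= j)%N -> 0 <= s <= T -> 0 <= b j s.
  by move=> j1 /(sol_nonneg hsol j1)[].
have a_cont j : (1 <= j)%N -> {within `[0, T], continuous (a j)}.
  by move=> /(sol_continuous hsol)[].
have b_cont j : (1 <= j)%N -> {within `[0, T], continuous (b j)}.
  by move=> /(sol_continuous hsol)[].
have eqs (t : R) : 0 < t < T -> 0 < t <= T by move=> /andP[-> /ltW].
split.
- apply: (species_continuously_differentiable K_ge0 J_ge0 K_cvg J_cvg
    a_ge0 b_ge0 a_cont b_cont aC bC i1 (c := a0 i)) => t /eqs.
  by move=> /(sol_equation hsol i1)[].
- apply: (species_continuously_differentiable K_ge0 J_ge0 K_cvg J_cvg
    b_ge0 a_ge0 b_cont a_cont bC aC i1 (c := b0 i)) => t /eqs.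
  by move=> /(sol_equation hsol i1)[].
Qed.
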